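(* The numbers $D_m(n)$ and $D_{\geq m}(n)$ defined in the context satisfy, for all integers $0\leq m<n$, the recurrence $$D_m(n)=\sum_{j=1}^m\sum_{i=1}^{n-m-1}\binom{n-m-1}{i-1}D_{\geq j}(i+j-1)\,D_{\geq m-j}(n-j-i),$$ with initial conditions $D_n(n)=1$ for all $n\ge 1$.
   Context: $S_n$ is the set of permutations of $\{1,\ldots,n\}$, written $\pi=\pi_1\cdots\pi_n$. A descent of $\pi$ is an index $i\in\{1,\ldots,n-1\}$ with $\pi_i>\pi_{i+1}$. The plot of $\pi$ is the set of points $(i,\pi_i)$. A hook of $\pi$ is given by a southwest endpoint $(i,\pi_i)$ and a northeast endpoint $(j,\pi_j)$ with $i<j$ and $\pi_i<\pi_j$; it is the L-shaped set $(\{i\}\times[\pi_i,\pi_j])\cup([i,j]\times\{\pi_j\})$. If $\pi$ has descents $d_1<\cdots<d_k$, a valid hook configuration of $\pi$ is a tuple $(H_1,\ldots,H_k)$ of hooks of $\pi$ such that: (1) for each $i$, the southwest endpoint of $H_i$ is $(d_i,\pi_{d_i})$; (2) no point of the plot lies directly above a hook (i.e., if a hook has endpoints $(i,\pi_i)$ and $(j,\pi_j)$ and $i<l<j$, then $\pi_l<\pi_j$); (3) hooks do not intersect each other, except that the northeast endpoint of one hook may be the southwest endpoint of another. $\mathrm{VHC}(\pi)$ is the set of valid hook configurations of $\pi$. The tail length $\mathrm{tl}(\pi)$ of $\pi\in S_n$ is the smallest nonnegative integer $i$ such that $\pi_{n-i}\neq n-i$, where the identity permutation of $S_n$ is understood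 to have tail length $n$. Define $D_m(n)=\sum_{\pi\in S_n,\ \mathrm{tl}(\pi)=m}|\mathrm{VHC}(\pi)|$ and $D_{\geq m}(n)=\sum_{\ell=m}^{n}D_\ell(n)$. Empty sums equal $0$. *)

(* Defs.v *)
From mathcomp Require Import all_boot all_order all_fingroup all_algebra.
From mathcomp Require Import all_classical all_reals.

Set Implicit Arguments.
Unset Strict Implicit.
Unset Printing Implicit Defensive.

(* Permutations of {1, ..., n} are elements p of 'S_n, which act on
   'I_n = {0, ..., n-1}: the ordinal i stands for the integer i.+1, both as a
   position and as a value. *)

Section HookConfigurations.
Variables (R : realType) (n : nat).
Implicit Types (p : 'S_n) (i j l : 'I_n).

Definition plot_point p i : R * R := ((i.+1)%:R, ((p i).+1)%:R)%R.

Definition is_descent p i : bool :=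
  [exists j : 'I_n, (j == i.+1 :> nat) && (p j < p i)].

(* [enum 'I_n] is increasing, hence so is this list. *)
Definition descents p : seq 'I_n := [seq i <- enum 'I_n | is_descent p i].

(* A hook is encoded by the positions (i, j) of its southwest and northeast
   endpoints. *)
Definition is_hook p (h : 'I_n * 'I_n) : bool :=
  (h.1 < h.2) && (p h.1 < p h.2).

Definition sw_endpoint p (h : 'I_n * 'I_n) : R * R := plot_point p h.1.

Definition ne_endpoint p (h : 'I_n * 'I_n) : R * R := plot_point p h.2.

Definition hook_set p (h : 'I_n * 'I_n) : set (R * R) :=
  let: (x1, y1) := sw_endpoint p h in
  let: (x2, y2) := ne_endpoint p h in
  (([set x1] `*` `[y1, y2]) `|` (`[x1, x2] `*` [set y2]))%classic.

Definition is_vhc p (H : (size (descents p)).-tuple ('I_n * 'I_n)) : Prop :=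
  [/\ forall a, is_hook p (tnth H a),
      forall a, (tnth H a).1 = tnth (in_tuple (descents p)) a,
      forall a l, (tnth H a).1 < l -> l < (tnth H a).2 ->
        p l < p (tnth H a).2
    & forall a b, a != b ->
        forall z : R * R, hook_set p (tnth H a) z -> hook_set p (tnth H b) z ->
          (z = ne_endpoint p (tnth H a) /\ z = sw_endpoint p (tnth H b)) \/
          (z = sw_endpoint p (tnth H a) /\ z = ne_endpoint p (tnth H b))].

Definition VHC p : {set (size (descents p)).-tuple ('I_n * 'I_n)} :=
  [set H | `[< is_vhc H >]]%SET.

(* [rev_ord i] has value n - i - 1, so it stands for the integer n - i; [find]
   returns n when no i qualifies, i.e. when p is the identity. *)
Definition tail_length p : nat :=
  find (fun i => p (rev_ord i) != rev_ord i) (enum 'I_n).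

End HookConfigurations.

Definition D (R : realType) (m n : nat) : nat :=
  \sum_(p : 'S_n | tail_length p == m) #|VHC R p|.

Definition D_geq (R : realType) (m n : nat) : nat :=
  \sum_(m <= l < n.+1) D R l n.

(* Main.v *)
(* The maximum n-m of the non-tail letters, if it is not last among them, is a
   descent top, and its hook must end at some tail point.  That hook splits the
   rest of a valid hook configuration into two independent ones: one on the
   points it shelters, one on the remaining points, where the maximum itself has
   become a tail letter.  Summing over the position of the maximum, the end of
   its hook and the set of values to its left gives the recurrence. *)

Require Import Defs.
From mathcomp Require Import all_boot all_order all_fingroup all_algebra.
From mathcomp Require Import all_classical all_reals.
From mathcomp Require Import zify.

Set Implicit Arguments.
Unset Strict Implicit.
Unset Printing Implicit Defensive.

Definition descent N (w : nat -> nat) i := (i.+1 < N) && (w i.+1 < w i).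

(* A word of length [N] is given by a function [w]; a hook configuration is
   encoded by the function [h] sending each descent to the position of the
   northeast endpoint of its hook, and fixing all other positions. The last
   condition says that hooks are nested or do not overlap: as no letter lies
   above a hook, this is equivalent to the geometric condition. *)
Definition valid N (w h : nat -> nat) : Prop :=
  (forall i, ~~ descent N w i -> h i = i) /\
  (forall i, descent N w i ->
     [/\ i < h i < N, forall l, i <= l < h i -> w l < w (h i)
       & forall l, i < l < h i -> h l < h i]).

Lemma valid_bound N w h i : valid N w h -> i < N -> h i < N.
Proof.
move=> [hf hd] iN; have [/hd[/andP[_ ?]] //|/hf->//] := boolP (descent N w i).
Qed.

Lemma valid_out N w h i : valid N w h -> N <= i -> h i = i.
Proof. by move=> [hf _] iN; apply: hf; rewrite /descent; lia. Qed.

Lemma valid_ge N w h i : valid N w h -> i <= h i.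
Proof.
move=> [hf hd]; have [/hd[/andP[/ltnW]] //|/hf->//] := boolP (descent N w i).
Qed.

(** * Splitting a configuration along the hook of the maximum *)

(* Below, [p] is the position of the maximum of the non-tail letters, [q] the
   number of non-tail letters after it, [m] the tail length, and the hook of [p]
   ends at the [j]-th tail letter, counted from 0. [inj_in] and [inj_out j]
   embed the positions of the sheltered and of the unsheltered letters. *)
Section Glue.
Variables (p q m : nat) (w : nat -> nat).
Let N := p.+1 + q + m.
Hypothesis q_gt0 : 0 < q.
Hypothesis w_max : forall l, l <= p + q -> l != p -> w l < w p.
Hypothesis w_tail : forall l l', p + q < l' -> l' < N -> l < l' -> w l < w l'.

Definition inj_out j x := if x <= p then x else x + (q + j.+1).
Definition inj_in x := p.+1 + x.

(** The end of the hook of [p], at position [p.+1 + q + j], lies in neither embedded word. Strict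
    nesting forbids two hooks with a common northeast endpoint, so no other hook can end there. *)
Definition hglue j (hU hS : nat -> nat) i :=
  if i < p then inj_out j (hU i)
  else if i == p then p.+1 + q + j
  else if i < p.+1 + q + j then inj_in (hS (i - p.+1))
  else i.

Lemma hglue_lt j hU hS i : i < p -> hglue j hU hS i = inj_out j (hU i).
Proof. by rewrite /hglue => ->. Qed.
Lemma hglue_max j hU hS : hglue j hU hS p = p.+1 + q + j.
Proof. by rewrite /hglue ltnn eqxx. Qed.
Lemma hglue_in j hU hS i : i < q + j -> hglue j hU hS (inj_in i) = inj_in (hS i).
Proof.
move=> ij; rewrite /hglue /inj_in; do ?case: ifP; try lia.
by move=> *; congr (p.+1 + hS _); lia.
Qed.
Lemma hglue_out j hU hS i : p.+1 + q + j <= i -> hglue j hU hS i = i.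
Proof. by move=> ij; rewrite /hglue; do ?case: ifP; try lia. Qed.

Lemma descent_max : descent N w p.
Proof. by rewrite /descent /N; have := @w_max p.+1; lia. Qed.

Lemma descent_tail i : p + q <= i -> ~~ descent N w i.
Proof.
move=> ij; apply/negP => /andP[iN]; rewrite /N in iN.
by have := @w_tail i i.+1; rewrite /N; lia.
Qed.

(** The last sheltered letter is followed in [w] by the end of the hook, a tail letter, so cutting
    there removes no descent. *)
Lemma descent_in j i : j < m ->
  descent (q + j) (w \o inj_in) i = (i < q + j) && descent N w (inj_in i).
Proof.
move=> jm; rewrite /descent /inj_in /= addnS /N.
have := @w_tail (p.+1 + i) (p.+1 + i).+1; rewrite /N; lia.
Qed.

(** In the unsheltered word the letter at [p] is followed by a larger tail letter or by nothing, so
    [p] stops being a descent. *)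
Lemma descent_U j i : j < m ->
  descent (p.+1 + (m - j.+1)) (w \o inj_out j) i = (i < p) && descent N w i.
Proof.
move=> jm; rewrite /descent /inj_out /= /N.
case: (ltnP i p) => ip /=; first by rewrite (ltnW ip); lia.

have := @w_tail i (i.+1 + (q + j.+1)).
have := @w_tail (i + (q + j.+1)) (i.+1 + (q + j.+1)); rewrite /N; case: ifP; lia.
Qed.

(** The two families do not interfere: sheltered hooks end before the hook of [p] does, and hooks
    starting left of [p] end either weakly left of [p] or beyond the end of its hook. *)
Lemma hglue_valid j hU hS : j < m ->
  valid (p.+1 + (m - j.+1)) (w \o inj_out j) hU ->
  valid (q + j) (w \o inj_in) hS -> valid N w (hglue j hU hS).
Proof.
move=> jm vU vS; have [hUf hUd] := vU; have [hSf hSd] := vS; split=> i.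
  move=> ndi; case: (ltnP i p) => ip.
    by rewrite hglue_lt // hUf ?descent_U ?ip // /inj_out (ltnW ip).
  case: (ltnP i (p.+1 + q + j)) => ij; last by rewrite hglue_out.
  have [ei|ni] := eqVneq i p; first by rewrite ei descent_max in ndi.
  have -> : i = inj_in (i - p.+1) by rewrite /inj_in; lia.
  rewrite hglue_in ?hSf ?descent_in //; try lia.
  by rewrite /inj_in subnKC ?(negbTE ndi) ?andbF //; lia.
move=> di; case: (ltnP i p) => ip.
  rewrite hglue_lt //; have /hUd[/andP[hU1 hU2] hU3 hU4] :
    descent (p.+1 + (m - j.+1)) (w \o inj_out j) i by rewrite descent_U // ip.
  split; first by rewrite /inj_out /N; case: ifP; lia.
    (* A hook ending weakly left of [p] covers the same letters in both words; any other ends at a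
       tail letter, which exceeds everything before it. *)
    move=> l /andP[l1 l2]; case: (leqP (hU i) p) => hp.
      have := hU3 l; rewrite /= /inj_out hp; case: ifP => lp; last first.
        by move: l2; rewrite /inj_out hp; lia.
      by apply; move: l2; rewrite /inj_out hp; lia.
    apply: w_tail => //; rewrite /inj_out /N; case: ifP; lia.
  move=> l /andP[l1 l2]; case: (ltnP l p) => lp.
    have ll : l < hU i by move: l2; rewrite /inj_out; case: ifP; lia.
    have := hU4 l; rewrite l1 ll => /(_ isT).
    by rewrite hglue_lt // /inj_out; do ?case: ifP; lia.
  have [el|nl] := eqVneq l p.
    by subst l; rewrite hglue_max; move: l2; rewrite /inj_out; case: ifP; lia.
  have hp : p < hU i by move: l2; rewrite /inj_out; case: ifP; lia.
  case: (ltnP l (p.+1 + q + j)) => ij; last by rewrite hglue_out.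
  have -> : l = inj_in (l - p.+1) by rewrite /inj_in; lia.
  rewrite hglue_in; last by lia.
  have := @valid_bound _ _ _ (l - p.+1) vS.
  by rewrite /inj_out /inj_in; case: ifP; lia.
have [ei|ni] := eqVneq i p.
  subst i; rewrite hglue_max; split; first by rewrite /N; lia.
    by move=> l /andP[l1 l2]; apply: w_tail; rewrite /N; lia.
  move=> l /andP[l1 l2].
  have -> : l = inj_in (l - p.+1) by rewrite /inj_in; lia.
  rewrite hglue_in; last by lia.
  have := @valid_bound _ _ _ (l - p.+1) vS.
  by rewrite /inj_in; lia.
case: (ltnP i (p + q)) => ij; last by rewrite (negbTE (descent_tail ij)) in di.
have [i' ei'] : exists i', i = inj_in i'.
  by exists (i - p.+1); rewrite /inj_in; lia.
subst i; have i'q : i' < q + j by move: ij; rewrite /inj_in; lia.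
have /hSd[hS1 hS3 hS4] : descent (q + j) (w \o inj_in) i'.
  by rewrite descent_in // i'q.
rewrite hglue_in //; split; first by move: hS1; rewrite /inj_in /N; lia.
  move=> l l1; have := hS3 (l - p.+1); rewrite /=.
  have -> : inj_in (l - p.+1) = l by move: l1; rewrite /inj_in; lia.
  by apply; move: l1; rewrite /inj_in; lia.
move=> l l1; have := hS4 (l - p.+1).
have -> : l = inj_in (l - p.+1) by move: l1; rewrite /inj_in; lia.
rewrite hglue_in; last by move: l1; rewrite /inj_in; lia.
by rewrite /inj_in addKn ltn_add2l; apply; move: l1; rewrite /inj_in; lia.
Qed.

(** Hook ends are pulled back through [inj_out] and [inj_in]. Positions from [p] on are fixed by
    [cut_out], as none of them is a descent of the unsheltered word. *)
Definition cut_out j (h : nat -> nat) x :=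
  if x < p then (if h x <= p then h x else h x - (q + j.+1)) else x.
Definition cut_in j (h : nat -> nat) x :=
  if x < q + j then h (inj_in x) - p.+1 else x.

Lemma cut_valid h : valid N w h -> exists j,
  [/\ j < m, valid (p.+1 + (m - j.+1)) (w \o inj_out j) (cut_out j h),
      valid (q + j) (w \o inj_in) (cut_in j h)
      & h = hglue j (cut_out j h) (cut_in j h)].
Proof.
move=> vh; have [hf hd] := vh; have [hp1 hp2 hp3] := hd _ descent_max.
have hpq : p + q < h p.
  rewrite ltnNge; apply/negP => hle; have := @w_max (h p) hle.
  by have := hp2 p; lia.
exists (h p - (p.+1 + q)); set j := h p - _.
have jm : j < m by rewrite /j; move: hp1; rewrite /N; lia.
have ej : h p = p.+1 + q + j by rewrite /j; lia.
have hin x : p < x -> x < p.+1 + q + j -> h x < p.+1 + q + j.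
  by move=> px xj; rewrite -ej; apply: hp3; lia.
(* A hook starting left of [p] cannot end strictly above [p] and weakly below
   the end of the hook of [p]. *)
have hout x : x < p -> h x <= p \/ p.+1 + q + j < h x.
  move=> xp; have [dx|/hf->] := boolP (descent N w x); last by left; lia.
  have [_ _ hx3] := hd _ dx; case: (leqP (h x) p) => hxp; first by left.
  by right; rewrite -ej; apply: hx3; lia.
have hge x : x <= h x := valid_ge x vh.
have hN x : x < N -> h x < N := valid_bound vh.
(* Cutting and then embedding again gives back [h]; this carries each condition over to the two
   shorter words. *)
have oc x : x < p -> inj_out j (cut_out j h x) = h x.
  by move=> xp; have := hout x xp; rewrite /inj_out /cut_out xp; do ?case: ifP; lia.
have ic x : x < q + j -> inj_in (cut_in j h x) = h (inj_in x).
  by move=> xp; have := hge (inj_in x); rewrite /cut_in xp /inj_in; lia.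
split=> //.
- split=> x; rewrite descent_U //.
    rewrite negb_and /cut_out; case: (ltnP x p) => //= xp /hf ->.
    by rewrite (ltnW xp).
  move=> /andP[xp dx]; have [hx1 hx2 hx3] := hd _ dx.
  have hxo := hout _ xp.
  have hxc : cut_out j h x = if h x <= p then h x else h x - (q + j.+1).
    by rewrite /cut_out xp.
  split.
  + by rewrite hxc; move: hx1; rewrite /N; case: ifP; lia.
  + move=> l l1 /=; rewrite oc //; apply: hx2; rewrite -(oc x) //.
    by move: l1; rewrite /inj_out; do ?case: ifP; lia.
  + move=> l l1; case: (ltnP l p) => lp; last by rewrite {1}/cut_out; case: ifP; lia.
    have : h l < h x.
      by apply: hx3; rewrite -(oc x) //; move: l1; rewrite /inj_out; do ?case: ifP; lia.
    by have := hout l lp; rewrite hxc /cut_out lp; do ?case: ifP; lia.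
- split=> x; rewrite descent_in //.
    rewrite negb_and /cut_in; case: (ltnP x (q + j)) => //= xq /hf ->.
    by rewrite /inj_in; lia.
  move=> /andP[xq dx]; have [hx1 hx2 hx3] := hd _ dx.
  have hxj : h (inj_in x) < p.+1 + q + j by apply: hin; rewrite /inj_in; lia.
  have exc := ic _ xq; split.
  + by move: hx1 hxj; rewrite -exc /inj_in; lia.
  + move=> l l1 /=; rewrite exc; apply: hx2; rewrite -exc.
    by move: l1; rewrite /inj_in; lia.
  + move=> l l1; have lq : l < q + j by move: exc; rewrite {1}/inj_in; lia.
    have : h (inj_in l) < h (inj_in x).
      by apply: hx3; rewrite -exc; move: l1; rewrite /inj_in; lia.
    by rewrite -exc -ic // /inj_in; lia.
- apply/funext => x; case: (ltnP x p) => xp; first by rewrite hglue_lt // oc.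
  have [->|nx] := eqVneq x p; first by rewrite hglue_max.
  case: (ltnP x (p.+1 + q + j)) => ij; last first.
    by rewrite hglue_out //; apply/hf/descent_tail; lia.
  have -> : x = inj_in (x - p.+1) by rewrite /inj_in; lia.
  by rewrite hglue_in ?ic //; lia.
Qed.

(** The value at [p] reveals [j], and the embeddings are injective. At positions that [hglue] does
    not read, valid functions are the identity. *)
Lemma hglue_inj j hU hS j' hU' hS' : j < m -> j' < m ->
  valid (p.+1 + (m - j.+1)) (w \o inj_out j) hU ->
  valid (q + j) (w \o inj_in) hS ->
  valid (p.+1 + (m - j'.+1)) (w \o inj_out j') hU' ->
  valid (q + j') (w \o inj_in) hS' ->
  hglue j hU hS = hglue j' hU' hS' -> [/\ j = j', hU = hU' & hS = hS'].
Proof.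
move=> jm jm' vU vS vU' vS' eg.
have ej : j = j' by have := congr1 (fun f => f p) eg; rewrite /= !hglue_max; lia.
subst j'; split=> //; apply/funext => x.
  case: (ltnP x p) => xp; last first.
    by rewrite (proj1 vU) ?(proj1 vU') // descent_U // ltnNge xp.
  have := congr1 (fun f => f x) eg; rewrite /= !hglue_lt // /inj_out.
  by do ?case: ifP; lia.
case: (ltnP x (q + j)) => xq; last by rewrite (valid_out vS xq) (valid_out vS' xq).
have := congr1 (fun f => f (inj_in x)) eg; rewrite /= !hglue_in // /inj_in; lia.
Qed.

End Glue.

(** * Counting valid configurations *)

Definition ffun_ext N (f : {ffun 'I_N -> 'I_N}) (i : nat) : nat :=
  if insub i is Some j then val (f j) else i.

Lemma ffun_ext_inj N : injective (@ffun_ext N).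
Proof.
move=> f g efg; apply/ffunP => i; apply/val_inj.
by have := congr1 (fun h => h (val i)) efg; rewrite /ffun_ext valK.
Qed.

(** A valid function is the identity from [N] on, so it is determined by a map of the finite type
    ['I_N]; this makes the configurations enumerable. *)
Definition vhcs N w : seq (nat -> nat) :=
  [seq ffun_ext f | f in [pred f : {ffun 'I_N -> 'I_N} | `[< valid N w (ffun_ext f) >]]].

Lemma vhcs_uniq N w : uniq (vhcs N w).
Proof. by rewrite map_inj_uniq ?enum_uniq //; apply: ffun_ext_inj. Qed.

Lemma mem_vhcs N w h : (h \in vhcs N w) = `[< valid N w h >].
Proof.
apply/fintype.imageP/asboolP => [[f /asboolP vf ->] //|vh].
pose f := [ffun i : 'I_N => Ordinal (valid_bound vh (ltn_ord i))].
have ef : h = ffun_ext f.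
  apply/funext => i; rewrite /ffun_ext; case: insubP => [j _ <-|]; first by rewrite ffunE.
  by rewrite -leqNgt => /(valid_out vh).
by exists f; first by rewrite inE -ef.
Qed.

Definition num_valid N w := size (vhcs N w).

Lemma num_valid_size N w (s : seq (nat -> nat)) : uniq s ->
  (forall h, h \in s <-> valid N w h) -> num_valid N w = size s.
Proof.
move=> us hs; apply/perm_size/uniq_perm => //; first exact: vhcs_uniq.
by move=> h; rewrite mem_vhcs; apply/asboolP/idP => /hs.
Qed.

(** Validity uses letters only through comparisons at positions below [N], so words may be replaced
    by any others with the same relative order. *)
Lemma valid_iso N w w' h :
  (forall i j, i < N -> j < N -> (w i < w j) = (w' i < w' j)) ->
  valid N w h -> valid N w' h.
Proof.
move=> ww [hf hd].
have dd i : descent N w' i = descent N w i.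
  by rewrite /descent; case: ltnP => //= iN; rewrite ww //; lia.
split=> i; rewrite dd; first exact: hf.
move=> /hd[h1 h2 h3]; split=> // l l1.
by rewrite -ww ?h2 //; lia.
Qed.

Lemma num_valid_iso N w w' :
  (forall i j, i < N -> j < N -> (w i < w j) = (w' i < w' j)) ->
  num_valid N w = num_valid N w'.
Proof.
move=> ww; apply: num_valid_size; first exact: vhcs_uniq.
move=> h; rewrite mem_vhcs; split=> [/asboolP|vh].
  by apply: valid_iso => i j iN jN; rewrite ww.
by apply/asboolP; apply: valid_iso vh.
Qed.

Lemma num_valid_increasing N w :
  (forall i j, i < j -> j < N -> w i < w j) -> num_valid N w = 1.
Proof.
move=> wi; rewrite (@num_valid_size _ _ [:: id]) // => h; rewrite inE.
have nd i : ~~ descent N w i.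
  by rewrite /descent; case: ltnP => //= iN; have := wi i i.+1; lia.
split=> [/eqP->|[hf _]]; first by split=> // i; rewrite (negbTE (nd i)).
by apply/eqP/funext => i; apply: hf.
Qed.

(** By [hglue_valid], [hglue_inj] and [cut_valid], [hglue] is a bijection from the disjoint union
    over [j] of pairs of configurations. *)
Lemma num_valid_glue p q m w : 0 < q ->
  (forall l, l <= p + q -> l != p -> w l < w p) ->
  (forall l l', p + q < l' -> l' < p.+1 + q + m -> l < l' -> w l < w l') ->
  num_valid (p.+1 + q + m) w =
    \sum_(j < m) num_valid (p.+1 + (m - j.+1)) (w \o inj_out p q j) *
                 num_valid (q + j) (w \o inj_in p).
Proof.
move=> q0 wm wt.
pose U (j : nat) := vhcs (p.+1 + (m - j.+1)) (w \o inj_out p q j).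
pose S (j : nat) := vhcs (q + j) (w \o inj_in p).
rewrite (@num_valid_size _ _ [seq hglue p q j x.1 x.2 | j <- iota 0 m,
    x <- [seq (f, g) | f <- U j, g <- S j]]).
- rewrite size_allpairs_dep sumnE big_map -(big_mkord xpredT
    (fun j => num_valid (p.+1 + (m - j.+1)) (w \o inj_out p q j) *
              num_valid (q + j) (w \o inj_in p))).
  by rewrite /index_iota subn0; apply: eq_bigr => j _; rewrite size_allpairs.
- apply: allpairs_uniq_dep; first exact: iota_uniq.
    by move=> j _; apply: allpairs_uniq; [exact: vhcs_uniq|exact: vhcs_uniq|move=> [a b] [c d]].
  move=> u v /allpairsPdep[j [x [+ + ->]]] /allpairsPdep[j' [x' [+ + ->]]] /=.
  rewrite !mem_iota !add0n /= => jm /allpairsP[[f g] /= []].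
  rewrite !mem_vhcs => /asboolP vf /asboolP vg -> /= jm'.
  move=> /allpairsP[[f' g'] /= []].
  rewrite !mem_vhcs => /asboolP vf' /asboolP vg' -> /= e.
  by have [-> -> ->] := hglue_inj q0 wt jm jm' vf vg vf' vg' e.
move=> h; split.
  move=> /allpairsPdep[j [x [+ + ->]]] /=.
  rewrite !mem_iota !add0n /= => jm /allpairsP[[f g] /= []].
  rewrite !mem_vhcs => /asboolP vf /asboolP vg -> /=.
  exact: (hglue_valid q0 wm wt jm vf vg).
move=> vh; have [j [jm vU vS eh]] := cut_valid q0 wm wt vh.
apply/allpairsPdep; exists j, (cut_out p q j h, cut_in p q j h); split=> //.
  by rewrite mem_iota.
by apply/allpairsP; exists (cut_out p q j h, cut_in p q j h); split=> //;
  rewrite mem_vhcs; apply/asboolP.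
Qed.

(** * Words with an increasing tail *)

Definition num_vhc (s : seq nat) := num_valid (size s) (nth 0 s).

Lemma num_vhc_iso (s s' : seq nat) : size s = size s' ->
  (forall i j, i < size s -> j < size s ->
     (nth 0 s i < nth 0 s j) = (nth 0 s' i < nth 0 s' j)) ->
  num_vhc s = num_vhc s'.
Proof. by rewrite /num_vhc => <-; apply: num_valid_iso. Qed.

Lemma nth_cat_iota (u : seq nat) b m i : i < size u + m ->
  nth 0 (u ++ iota b m) i = if i < size u then nth 0 u i else b + (i - size u).
Proof. by move=> im; rewrite nth_cat; case: ltnP => // ui; rewrite nth_iota //; lia. Qed.

Lemma nth_lt b (u : seq nat) i : all (fun x => x < b) u -> i < size u -> nth 0 u i < b.
Proof. by move=> /allP ub iu; apply/ub/mem_nth. Qed.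

(** Up to relative order, [b] and the [m - j - 1] letters beyond its hook form a tail of length
    [m - j], and the [j] sheltered tail letters may be lowered by one so as to start at [b]. *)
Lemma num_vhc_glue (u v : seq nat) b m : 0 < size v ->
  all (fun x => x < b) u -> all (fun x => x < b) v ->
  num_vhc (u ++ b :: v ++ iota b.+1 m) =
    \sum_(j < m) num_vhc (u ++ iota b (m - j)) * num_vhc (v ++ iota b j).
Proof.
move=> v0 ub vb; rewrite /num_vhc; set w := nth 0 (u ++ _).
have nthw i : i < (size u).+1 + size v + m -> w i = if i < size u then nth 0 u i else
    if i == size u then b else if i < (size u).+1 + size v
    then nth 0 v (i - (size u).+1) else b.+1 + (i - (size u).+1 - size v).
  move=> im; rewrite /w nth_cat; case: ltnP => // ui.
  have [->|iu] := eqVneq i (size u); first by rewrite subnn.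
  have -> : i - size u = (i - (size u).+1).+1 by lia.
  rewrite /= nth_cat_iota; last by lia.
  by do ?case: ifP; lia.
have -> : size (u ++ b :: v ++ iota b.+1 m) = (size u).+1 + size v + m.
  by rewrite size_cat /= size_cat size_iota; lia.
have nu i := @nth_lt b u i ub; have nv i := @nth_lt b v i vb.
rewrite num_valid_glue //.
- apply: eq_bigr => -[j jm] _ /=; rewrite !size_cat !size_iota; congr (_ * _).
    have -> : size u + (m - j) = (size u).+1 + (m - j.+1) by lia.
    apply: num_valid_iso => x y xN yN /=.
    rewrite !nth_cat_iota ?nthw /inj_out; try (by lia); try (by case: ifP; lia).
    have := nu x; have := nu y.
    by case: (ltngtP x (size u)) => ?; case: (ltngtP y (size u)) => ?; do ?case: ifP; lia.
  apply: num_valid_iso => x y xN yN /=.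
  rewrite !nth_cat_iota ?nthw /inj_in; try (by lia).
  have exx z : (size u).+1 + z - (size u).+1 = z by lia.
  rewrite !exx; have := nv x; have := nv y.
  by do ?case: ifP; lia.
- move=> l l1 l2; rewrite !nthw; try lia.
  have := nu l; have := nv (l - (size u).+1); do ?case: ifP; lia.
- move=> l l' l1 l2 l3; rewrite !nthw; try lia.
  have := nu l; have := nv (l - (size u).+1); do ?case: ifP; lia.
Qed.

Lemma num_vhc_map f (u : seq nat) b b' m :
  {in u &, {mono f : x y / x < y}} ->
  all (fun x => x < b) u -> all (fun x => x < b') (map f u) ->
  num_vhc (map f u ++ iota b' m) = num_vhc (u ++ iota b m).
Proof.
move=> fm ub fub.
apply: num_vhc_iso; rewrite !size_cat !size_iota size_map // => i j im jm.
rewrite !nth_cat_iota ?size_map //.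
have nu i := @nth_lt b u i ub; have nv i := @nth_lt b' _ i fub.
have nm z : z < size u -> nth 0 (map f u) z = f (nth 0 u z) by exact: nth_map.
have {}nv z : z < size u -> f (nth 0 u z) < b' by move=> zu; rewrite -nm ?nv ?size_map.
have := nu i; have := nu j; have := nv i; have := nv j.
case: (ltnP i (size u)) => iu; case: (ltnP j (size u)) => ju; rewrite ?nm //; try lia.
by rewrite fm ?mem_nth.
Qed.

(** This is $D_{\geq m}(k+m)$, as [D_geq_tail_sum] shows: the last [m] letters are fixed and the
    others arbitrary. *)
Definition tail_sum k m := \sum_(w <- permutations (iota 0 k)) num_vhc (w ++ iota k m).

(** Standardisation: for [t] the sorted list, [nth 0 t] is the increasing map from ranks to letters,
    and counts depend on relative order only. *)
Lemma sum_permutations (s : seq nat) b m : uniq s -> all (fun x => x < b) s ->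
  \sum_(w <- permutations s) num_vhc (w ++ iota b m) = tail_sum (size s) m.
Proof.
move=> us sb; set t := sort leq s.
have st : perm_eq s t by rewrite perm_sym perm_sort.
have ts : size t = size s by rewrite size_sort.
have tm : {in iota 0 (size s) &, {mono nth 0 t : x y / x < y}}.
  move=> x y; rewrite !mem_iota !add0n /= => xs ys.
  have tlt a c : a < c -> c < size s -> nth 0 t a < nth 0 t c.
    move=> ac cs; apply: (sorted_ltn_nth ltn_trans) => //; rewrite ?inE ?ts //; try lia.
    by rewrite ltn_sorted_uniq_leq sort_uniq us sort_sorted //; exact: leq_total.
  by case: (ltngtP x y) => [xy|xy|->]; [exact: tlt|have := tlt _ _ xy xs; lia|rewrite ltnn].
have et : t = map (nth 0 t) (iota 0 (size s)).
  by rewrite -ts map_nth_iota0 // take_size.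
have it : {in iota 0 (size s) &, injective (nth 0 t)}.
  move=> x y xi yi; have := tm x y xi yi; have := tm y x yi xi; lia.
have -> : \sum_(w <- permutations s) num_vhc (w ++ iota b m) =
    \sum_(w <- [seq map (nth 0 t) w | w <- permutations (iota 0 (size s))])
       num_vhc (w ++ iota b m).
  apply/perm_big; rewrite perm_sym.
  have um : uniq [seq map (nth 0 t) w | w <- permutations (iota 0 (size s))].
    rewrite map_inj_in_uniq ?permutations_uniq // => x y.
    rewrite !mem_permutations => xi yi; apply: (inj_in_map it).
      by apply/allP => z; rewrite (perm_mem xi).
    by apply/allP => z; rewrite (perm_mem yi).
  apply: uniq_perm => //; first exact: permutations_uniq.
  apply: (uniq_min_size um _ _).2.
    move=> _ /mapP[v vi ->]; move: vi; rewrite !mem_permutations => vi.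
    by rewrite (permPr st) {2}et perm_map.
  by rewrite size_map !size_permutations ?iota_uniq // size_iota.
rewrite big_map big_seq /tail_sum [RHS]big_seq; apply: eq_bigr => w.
rewrite mem_permutations => wi; apply: num_vhc_map.
- by move=> x y xw yw; apply: tm; rewrite -(perm_mem wi).
- by apply/allP => x; rewrite (perm_mem wi) mem_iota add0n.
- rewrite (perm_all _ (perm_map _ wi)) -et (perm_all _ (_ : perm_eq t s)) //.
  by rewrite perm_sort.
Qed.

(** * The set of letters to the left of the maximum *)

Definition elems k (A : {set 'I_k}) : seq nat := [seq val i | i <- enum A].

Lemma mem_elems k (A : {set 'I_k}) (i : 'I_k) : (val i \in elems A) = (i \in A).
Proof. by rewrite mem_map ?mem_enum //; apply: val_inj. Qed.

Lemma elems_lt k (A : {set 'I_k}) x : x \in elems A -> x < k.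
Proof. by case/mapP => i _ ->; apply: ltn_ord. Qed.

Lemma elems_uniq k (A : {set 'I_k}) : uniq (elems A).
Proof. by rewrite map_inj_uniq ?enum_uniq //; apply: val_inj. Qed.

Lemma size_elems k (A : {set 'I_k}) : size (elems A) = #|A|.
Proof. by rewrite size_map cardE. Qed.

Lemma all_elems_lt k (A : {set 'I_k}) s :
  s \in permutations (elems A) -> all (fun x => x < k) s.
Proof.
by rewrite mem_permutations => sA; apply/allP => x; rewrite (perm_mem sA) => /elems_lt.
Qed.

Lemma perm_iotaS k : perm_eq (iota 0 k.+1) (k :: iota 0 k).
Proof. by rewrite -addn1 iotaD perm_catC. Qed.

(** Here [A] collects the letters left of the maximum [k]. As [k] occurs in neither half, its
    position determines [u] and [v], and [u] determines [A]. *)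
Lemma perm_eq_split_max k :
  perm_eq (permutations (iota 0 k.+1))
    [seq x.1 ++ k :: x.2 | A <- enum {: {set 'I_k}},
       x <- [seq (u, v) | u <- permutations (elems A),
                          v <- permutations (elems (~: A)%SET)]].
Proof.
apply: uniq_perm; first exact: permutations_uniq.
  apply: allpairs_uniq_dep; first exact: enum_uniq.
    move=> A _; apply: allpairs_uniq; [exact: permutations_uniq|exact: permutations_uniq|].
    by move=> [a b] [c d].
  move=> x y /allpairsPdep[A [_ [_ /allpairsP[[u v] /= [uA vA ->]] ->]]].
  move=> /allpairsPdep[A' [_ [_ /allpairsP[[u' v'] /= [uA' vA' ->]] ->]]] /= e.
  have nk B s : s \in permutations (@elems k B) -> k \notin s.
    by move=> /all_elems_lt/allP sk; apply/negP => /sk; rewrite ltnn.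
  have eu : size u = size u'.
    have := congr1 (index k) e; rewrite !index_cat.
    by rewrite (negbTE (nk _ _ uA)) (negbTE (nk _ _ uA')) /= eqxx !addn0.
  move/eqP: e; rewrite eqseq_cat // => /andP[/eqP euu /eqP [evv]].
  suff -> : A = A' by rewrite euu evv.

  apply/setP => i; rewrite -!mem_elems; move: uA uA'; rewrite !mem_permutations.
  by move=> /perm_mem <- /perm_mem <-; rewrite euu.
move=> w; rewrite mem_permutations; apply/idP/allpairsPdep.
  move=> wi; have kw : k \in w by rewrite (perm_mem wi) mem_iota; lia.
  move: wi; case/splitPr: kw => u v wi.
  have uvi : perm_eq (u ++ v) (iota 0 k).
    have e : perm_eq (u ++ k :: v) (k :: u ++ v) by rewrite -[k :: v]cat1s perm_catCA.
    rewrite -(perm_cons k) -(permPl e) (permPl wi).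
    exact: perm_iotaS.
  have uvu : uniq (u ++ v) by rewrite (perm_uniq uvi) iota_uniq.
  pose A : {set 'I_k} := [set i | val i \in u]%SET.
  have memuv x : (x \in u) || (x \in v) = (x < k).
    by rewrite -mem_cat (perm_mem uvi) mem_iota.
  have nuv x : x \in u -> x \notin v.
    move=> xu; move: uvu; rewrite cat_uniq => /and3P[_ /hasPn/(_ x) h _].
    by apply/negP => /h/negP; apply.
  exists A, (u, v); split; rewrite ?mem_enum //=.
  move: uvu; rewrite cat_uniq => /and3P[uu _ vu].
  apply/allpairsP; exists (u, v); split=> //=; rewrite mem_permutations;
    apply: uniq_perm => //; try exact: elems_uniq; move=> x.
    case: (ltnP x k) => xk; last first.
      by apply/idP/idP => [xu|/elems_lt]; [have := memuv x; rewrite xu|]; lia.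
    by rewrite (mem_elems A (Ordinal xk)) inE.
  case: (ltnP x k) => xk; last first.
    by apply/idP/idP => [xu|/elems_lt]; [have := memuv x; rewrite xu orbT|]; lia.
  rewrite (mem_elems _ (Ordinal xk)) !inE /=; have := memuv x; have := nuv x.
  by rewrite xk; do 2 case: (_ \in _) => //; move=> /(_ isT).
move=> [A [_ [_ /allpairsP[[u v] /= [uA vA ->]] ->]]] /=.
rewrite -[k :: v]cat1s perm_catCA (permPr (perm_iotaS k)) perm_cons.
move: uA vA; rewrite !mem_permutations => uA vA.
rewrite (permPl (perm_cat uA vA)); apply: uniq_perm; rewrite ?iota_uniq //.
  rewrite cat_uniq !elems_uniq andbT /=; apply/hasPn => x /mapP[i].
  by rewrite mem_enum !inE => iA ->; rewrite mem_elems.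
move=> x; rewrite mem_cat mem_iota add0n /=; case: (ltnP x k) => xk; last first.
  by apply/negbTE/negP => /orP[] /elems_lt; lia.
by rewrite !(mem_elems _ (Ordinal xk)) !inE orbN.
Qed.

Lemma sum_card_set k (f : nat -> nat) :
  \sum_(A : {set 'I_k}) f #|A| = \sum_(i < k.+1) 'C(k, i) * f i.
Proof.
have ck (A : {set 'I_k}) : #|A| < k.+1 by rewrite ltnS (leq_trans (max_card _)) ?card_ord.
rewrite (partition_big (fun A => Ordinal (ck A)) xpredT) //=.
apply: eq_bigr => i _; rewrite (eq_bigr (fun=> f i)); last first.
  by move=> A /eqP <-.
rewrite sum_nat_const; congr (_ * _).
have := card_draws 'I_k i; rewrite card_ord => <-; apply: eq_card => A.
by rewrite !inE.
Qed.

(** The sum is split by the set [A] of letters left of [k], of size [i]. If [A] is everything, [k]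
    lengthens the tail by one; otherwise [k] is a descent top and [num_vhc_glue] factors the
    count. *)
Lemma tail_sum_rec k m : tail_sum k.+1 m =
  tail_sum k m.+1 + \sum_(i < k) 'C(k, i) *
    \sum_(j < m) tail_sum i (m - j) * tail_sum (k - i) j.
Proof.
rewrite {1}/tail_sum (perm_big _ (perm_eq_split_max k)) big_allpairs_dep /= enumT.
pose f i := if i == k then tail_sum k m.+1 else
    \sum_(j < m) tail_sum i (m - j) * tail_sum (k - i) j.
rewrite (eq_bigr (fun A : {set 'I_k} => f #|A|)).
  rewrite sum_card_set big_ord_recr /= binn mul1n /f eqxx addnC; congr (_ + _).
  by apply: eq_bigr => i _; rewrite ltn_eqF.
move=> A _; rewrite big_allpairs /=.
have cC : #|~: A|%SET = k - #|A| by rewrite cardsCs finset.setCK card_ord.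
have all_elems B : all (fun x => x < k) (@elems k B) by apply/allP => x /elems_lt.
have cA : #|A| <= k by rewrite (leq_trans (max_card _)) ?card_ord.
rewrite /f; case: eqP => ek.
  have -> : elems (~: A)%SET = [::].
    by apply: size0nil; rewrite size_elems cC ek subnn.
  rewrite -[in RHS]ek -size_elems -(sum_permutations _ (elems_uniq A) (all_elems _)).
  (* The empty word is the only arrangement of the complement, and [k :: iota k.+1 m] is
     [iota k m.+1]. *)
  by apply: eq_bigr => u _; rewrite big_seq1 -catA.
transitivity (\sum_(j < m) \sum_(u <- permutations (elems A))
    \sum_(v <- permutations (elems (~: A)%SET))
     num_vhc (u ++ iota k (m - j)) * num_vhc (v ++ iota k j)).
  rewrite [RHS]exchange_big /= big_seq [RHS]big_seq; apply: eq_bigr => u uA.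
  rewrite [RHS]exchange_big /= big_seq [RHS]big_seq; apply: eq_bigr => v vA.
  rewrite -catA; apply: num_vhc_glue (all_elems_lt uA) (all_elems_lt vA).
  move: vA; rewrite mem_permutations => /perm_size ->.
  by rewrite size_elems cC subn_gt0 ltn_neqAle cA andbT; apply/eqP.
apply: eq_bigr => j _.
rewrite -cC -!size_elems -(sum_permutations _ (elems_uniq A) (all_elems _)).
rewrite -(sum_permutations _ (elems_uniq _) (all_elems _)) big_distrl /=.
by apply: eq_bigr => u _; rewrite big_distrr.
Qed.

(** * From geometric to combinatorial configurations *)

Definition word n (p : 'S_n) : seq nat := [seq val (p i) | i <- enum 'I_n].

Lemma size_word n (p : 'S_n) : size (word p) = n.
Proof. by rewrite size_map size_enum_ord. Qed.

Lemma nth_word n (p : 'S_n) (i : 'I_n) : nth 0 (word p) i = p i.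
Proof. by rewrite (nth_map i) ?nth_ord_enum // size_enum_ord. Qed.

Section GeometricHooks.
Variables (R : realType) (n : nat) (p : 'S_n).
Implicit Types (i : 'I_n) (a b : 'I_n * 'I_n).

Let w := nth 0 (word p).
Let wE i : w i = p i := nth_word p i.

Lemma is_descentE i : is_descent p i = descent n w i.
Proof.
rewrite /descent; apply/existsP/andP => [[j /andP[/eqP ji pji]]|[ij wij]].
  by rewrite -ji wE wE ltn_ord.
by exists (Ordinal ij); rewrite eqxx /= -!wE.
Qed.

Lemma mem_descents i : (i \in descents p) = descent n w i.
Proof. by rewrite mem_filter mem_enum andbT is_descentE. Qed.

Lemma descents_uniq : uniq (descents p).
Proof. by rewrite filter_uniq ?enum_uniq. Qed.

Lemma hook_setP a (z : R * R) : hook_set p a z <->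
  (z.1 = (a.1.+1)%:R /\ (p a.1).+1%:R <= z.2 <= (p a.2).+1%:R \/
   a.1.+1%:R <= z.1 <= a.2.+1%:R /\ z.2 = (p a.2).+1%:R)%R.
Proof.
rewrite /hook_set /sw_endpoint /ne_endpoint /plot_point /=.
by split=> -[] /= [] /=; rewrite ?in_itv /= => ? ?; [left|right|left|right]; split.
Qed.

Definition under a := forall l : 'I_n, a.1 < l -> l < a.2 -> p l < p a.2.

Definition hooks_meet_at_endpoints a b := forall z : R * R,
  hook_set p a z -> hook_set p b z ->
  (z = ne_endpoint R p a /\ z = sw_endpoint R p b) \/
  (z = sw_endpoint R p a /\ z = ne_endpoint R p b).

(** If [b] started under [a] without ending before it, the vertical side of [b] would cross the
    horizontal side of [a]. *)
Lemma hooks_meet_nested a b : under a -> under b -> is_hook p b ->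
  a.1 < b.1 -> hooks_meet_at_endpoints a b -> b.1 < a.2 -> b.2 < a.2.
Proof.
move=> ua ub /andP[b12 _] ab meet ba; rewrite ltnNge; apply/negP => a2b2.
have pab : p a.2 <= p b.2.
  move: a2b2; rewrite leq_eqVlt => /orP[/eqP/val_inj->//|a2b2].
  exact/ltnW/ub.
have pba : p b.1 < p a.2 by exact: ua.
(* The crossing point. Its column is strictly between those of the endpoints of [a], so it is not an
   allowed intersection. *)
pose z : R * R := (b.1.+1%:R, (p a.2).+1%:R)%R.
have za : hook_set p a z.
  by apply/hook_setP; right; rewrite /z /= !Num.Theory.ler_nat; split=> //; lia.
have zb : hook_set p b z.
  by apply/hook_setP; left; rewrite /z /= !Num.Theory.ler_nat; split=> //; lia.
have [[[]]|[[]]] := meet z za zb.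
  by move=> /eqP; rewrite Num.Theory.eqr_nat; lia.
by move=> /eqP; rewrite Num.Theory.eqr_nat; lia.
Qed.

(** The vertical side of [a] lies left of [b]. Where the horizontal side of [a] meets the vertical
    side of [b], nesting forces [b.1 = a.2]; two horizontal sides at equal height would have the
    same end, which nesting excludes. *)
Lemma hooks_nested_meet a b : under a -> is_hook p b ->
  a.1 < b.1 -> (b.1 < a.2 -> b.2 < a.2) -> hooks_meet_at_endpoints a b.
Proof.
move=> ua /andP[b12 _] ab nest [x y].
move=> /hook_setP/=[[-> _]|[hx ->]] /hook_setP/=[[]|[]].
- by move=> /eqP; rewrite Num.Theory.eqr_nat; lia.
- by rewrite !Num.Theory.ler_nat; lia.
- move=> xE; subst x; rewrite !Num.Theory.ler_nat !ltnS in hx * => /andP[_ pab].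
  have /andP[_ ba] := hx.
  left; rewrite /ne_endpoint /sw_endpoint /plot_point.
  suff e : b.1 = a.2 by rewrite e.
  apply/val_inj/eqP; rewrite /= eqn_leq ba leqNgt; apply/negP => /[dup] /nest b2.
  by have := ua b.2; lia.
- move=> _ /eqP; rewrite Num.Theory.eqr_nat => /eqP[] /val_inj/perm_inj e.
  by move: nest; rewrite e; lia.
Qed.

Lemma hooks_meet_at_endpointsC a b :
  hooks_meet_at_endpoints a b -> hooks_meet_at_endpoints b a.
Proof. by move=> meet z zb za; case: (meet z za zb) => -[? ?]; [right|left]. Qed.

Let ds := descents p.
Implicit Types (H : (size ds).-tuple ('I_n * 'I_n)).

(** For a non-descent the index is out of range, and the default [x] of [nth] makes it a fixed
    point. *)
Definition hook_fun H (x : nat) : nat :=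
  nth x [seq val h.2 | h <- H] (index x [seq val i | i <- ds]).

Lemma hook_fun_tnth H c : hook_fun H (tnth (in_tuple ds) c) = (tnth H c).2.
Proof.
rewrite /hook_fun (tnth_nth (tnth (in_tuple ds) c)) /= index_map; last exact: val_inj.
rewrite index_uniq ?descents_uniq // (nth_map (tnth H c)) ?size_tuple //.
by rewrite -tnth_nth.
Qed.

Lemma hook_fun_nondescent H (x : nat) : ~~ descent n w x -> hook_fun H x = x.
Proof.
move=> dx; rewrite /hook_fun nth_default // size_map size_tuple leqNgt.
rewrite -(size_map val ds) index_mem; apply/negP => /mapP[i].
by rewrite mem_descents => di xi; rewrite xi di in dx.
Qed.

Lemma tnth_descents i : descent n w i -> exists c, i = tnth (in_tuple ds) c.
Proof. by rewrite -mem_descents => /seq_tnthP[c ->]; exists c. Qed.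

(** The condition on southwest endpoints stays explicit because [hook_fun] records only northeast
    ones. Intersections are compared pairwise, the hook starting further left playing the part of
    [a]. *)
Lemma is_vhcP H : is_vhc R H <->
  (forall c, (tnth H c).1 = tnth (in_tuple ds) c) /\ valid n w (hook_fun H).
Proof.
split=> [[hh sw ab meet]|[sw [hf hd]]].
  split=> //; split=> x; first exact: hook_fun_nondescent.
  move=> dx; have xn : x < n by move: dx => /andP[]; lia.
  have [c ec] := @tnth_descents (Ordinal xn) dx.
  have -> : hook_fun H x = (tnth H c).2 by rewrite -hook_fun_tnth -ec.
  have {}ec : x = (tnth H c).1 by rewrite sw -ec.
  have /andP[h1 h2] := hh c.
  split; first by rewrite ec h1 ltn_ord.
    move=> l /andP[xl l2]; have ln : l < n by rewrite (ltn_trans l2).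
    rewrite wE; have := wE (Ordinal ln) => /= ->.
    move: xl; rewrite leq_eqVlt => /orP[/eqP xl|xl].
      by rewrite (_ : Ordinal ln = (tnth H c).1) //; apply/val_inj; rewrite /= -xl ec.
    by apply: ab; rewrite -?ec.
  move=> l /andP[xl l2]; have [dl|/hook_fun_nondescent->//] := boolP (descent n w l).
  have ln : l < n by rewrite (ltn_trans l2).
  have [c' ec'] := @tnth_descents (Ordinal ln) dl.
  have -> : hook_fun H l = (tnth H c').2 by rewrite -hook_fun_tnth -ec'.
  have {}ec' : l = (tnth H c').1 by rewrite sw -ec'.
  apply: hooks_meet_nested; rewrite -?ec -?ec' //; try exact: ab.
  move=> z; apply: meet; apply/eqP => cc'; move: ec'; rewrite -cc' -ec; lia.
have dc c : descent n w (tnth H c).1 by rewrite sw -mem_descents mem_tnth.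
have hc c : hook_fun H (tnth H c).1 = (tnth H c).2 by rewrite sw hook_fun_tnth.
have ab c : under (tnth H c).
  move=> l l1 l2; have [_ + _] := hd _ (dc c); rewrite hc -!wE.
  by apply; rewrite l2 ltnW.
have hh c : is_hook p (tnth H c).
  have [] := hd _ (dc c); rewrite hc => /andP[h1 _] h2 _.
  by rewrite /is_hook h1 -!wE h2 // leqnn.
split=> // c c' cc'.
have : (tnth H c).1 != (tnth H c').1.
  rewrite !sw; apply: contra cc' => /eqP; rewrite !(tnth_nth (tnth H c).1) /= => /eqP.
  by rewrite nth_uniq ?descents_uniq.
have nest d d' : (tnth H d).1 < (tnth H d').1 ->
    hooks_meet_at_endpoints (tnth H d) (tnth H d').
  move=> dd; apply: hooks_nested_meet => // d2.
  have [_ _] := hd _ (dc d); rewrite hc => /(_ (tnth H d').1).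
  by rewrite dd d2 hc => /(_ isT).
rewrite neq_ltn => /orP[/nest//|/nest/hooks_meet_at_endpointsC]; exact.
Qed.

Lemma card_VHC : #|VHC R p| = num_vhc (word p).
Proof.
rewrite /num_vhc size_word cardE -(size_map hook_fun).
apply/esym/num_valid_size.
  rewrite map_inj_in_uniq ?enum_uniq // => H H'.
  rewrite !mem_enum !inE => /is_vhcP[sw _] /is_vhcP[sw' _] e.
  apply: eq_from_tnth => c; rewrite [tnth H c]surjective_pairing [tnth H' c]surjective_pairing.
  by rewrite sw sw'; congr pair; apply: val_inj; rewrite /= -!hook_fun_tnth e.
move=> h; split.
  by move=> /mapP[H]; rewrite mem_enum !inE => /is_vhcP[_ ?] ->.
(* The preimage of [h]: one hook per descent, in order, with its northeast endpoint read off [h]. *)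
move=> vh; pose f i := Ordinal (valid_bound vh (ltn_ord i)).
pose H : (size ds).-tuple ('I_n * 'I_n) := map_tuple (fun i => (i, f i)) (in_tuple ds).
have eh : h = hook_fun H.
  apply/funext => x; have [dx|dx] := boolP (descent n w x).
    have xn : x < n by move: dx => /andP[]; lia.
    have [c ec] := @tnth_descents (Ordinal xn) dx.
    have := hook_fun_tnth H c; rewrite -ec /= => ->.
    by rewrite tnth_map -ec.
  by rewrite hook_fun_nondescent //; apply: (proj1 vh).
apply/mapP; exists H => //; rewrite mem_enum inE; apply/asboolP/is_vhcP.
by split; [move=> c; rewrite tnth_map | rewrite -eh].
Qed.

End GeometricHooks.

(** * Tail lengths and the recurrence *)

Lemma perm_words n :
  perm_eq [seq word p | p : 'S_n] (permutations (iota 0 n)).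
Proof.
have uw : uniq [seq word p | p : 'S_n].
  rewrite map_inj_uniq ?enum_uniq // => p q e; apply/permP => i.
  by apply: val_inj; rewrite /= -!nth_word e.
apply: uniq_perm => //; first exact: permutations_uniq.
apply: (uniq_min_size uw _ _).2.
  move=> _ /mapP[p _ ->]; rewrite mem_permutations.
  have up : uniq (word p).
    by rewrite map_inj_uniq ?enum_uniq // => i j /val_inj/perm_inj.
  apply: uniq_perm; rewrite ?iota_uniq //.
  apply: (uniq_min_size up _ _).2; rewrite ?size_word ?size_iota //.
  by move=> _ /mapP[i _ ->]; rewrite mem_iota /= ltn_ord.
by rewrite size_map -cardE card_Sn size_permutations ?iota_uniq // size_iota.
Qed.

Lemma tail_length_max n (p : 'S_n) : tail_length p <= n.
Proof. by rewrite (leq_trans (find_size _ _)) // size_enum_ord. Qed.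

(** That [find] returns at least [m] means that the first [m] ordinals fail the test; [rev_ord]
    sends them to the last [m] positions, which are then fixed. *)
Lemma tail_length_geq k m (p : 'S_(k + m)) :
  (m <= tail_length p) = (drop k (word p) == iota k m).
Proof.
rewrite leqNgt -has_take_leq; last by rewrite size_enum_ord leq_addl.
apply/hasPn/eqP => [fixp|dw i].
  apply: (@eq_from_nth _ 0) => [|i]; rewrite size_drop size_word addKn ?size_iota // => im.
  have ikm : k + i < k + m by rewrite ltn_add2l.
  rewrite nth_drop nth_iota //; have := nth_word p (Ordinal ikm) => /= ->.
  have /fixp : rev_ord (Ordinal ikm) \in take m (enum 'I_(k + m)).
    rewrite -(mem_map val_inj) map_take val_enum_ord take_iota mem_iota /=; lia.
  by rewrite negbK rev_ordK => /eqP ->.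
rewrite -(mem_map val_inj) map_take val_enum_ord take_iota mem_iota /= => im.
rewrite negbK; apply/eqP/val_inj; rewrite -[LHS]nth_word.
have -> : val (rev_ord i) = k + (m - i.+1) by rewrite /=; lia.
by rewrite -nth_drop dw nth_iota /=; lia.
Qed.

Lemma D_geq_sum (R : realType) m n :
  D_geq R m n = \sum_(p : 'S_n | m <= tail_length p) num_vhc (word p).
Proof.
rewrite /D_geq /D (exchange_big_dep xpredT) //= [RHS]big_mkcond.
apply: eq_bigr => p _; under eq_bigl do rewrite eq_sym.
by rewrite big_nat1_eq card_VHC ltnS tail_length_max andbT.
Qed.

Lemma D_geq_tail_sum (R : realType) k m : D_geq R m (k + m) = tail_sum k m.
Proof.
rewrite D_geq_sum (eq_bigl _ _ (@tail_length_geq k m)).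
transitivity (\sum_(s <- [seq word p | p : 'S_(k + m)] |
    drop k s == iota k m) num_vhc s).
  by rewrite big_map enumT.
rewrite (perm_big _ (perm_words _)) -big_filter /tail_sum.
rewrite -(big_map (fun w => w ++ iota k m) xpredT num_vhc).
apply/perm_big/uniq_perm; first by rewrite filter_uniq ?permutations_uniq.
  rewrite map_inj_in_uniq ?permutations_uniq // => s t.
  rewrite !mem_permutations => /perm_size es /perm_size et /eqP.
  by rewrite eqseq_cat ?es ?et // => /andP[/eqP].
move=> s; rewrite mem_filter mem_permutations iotaD add0n.
apply/andP/mapP => [[/eqP ds ps]|[t + ->]].
  exists (take k s); last by rewrite -ds cat_take_drop.
  by rewrite mem_permutations -(perm_cat2r (iota k m)) -{1}ds cat_take_drop.
rewrite mem_permutations => tk; rewrite perm_cat2r; split=> //.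
by rewrite -[k in drop k _](size_iota 0) -(perm_size tk) drop_size_cat.
Qed.

Theorem theorem6p2 (R : realType) :
  (forall m n : nat, m < n ->
     D R m n =
       \sum_(1 <= j < m.+1) \sum_(1 <= i < (n - m - 1).+1)
          'C(n - m - 1, i - 1) * D_geq R j (i + j - 1)
            * D_geq R (m - j) (n - j - i)) /\
  (forall n : nat, 1 <= n -> D R n n = 1).
Proof.
split=> [m n mn|n _]; last first.
  have -> : D R n n = D_geq R n (0 + n) by rewrite /D_geq big_nat1.
  (* With no letter outside the tail, only the increasing word remains, and it has no descents. *)
  rewrite D_geq_tail_sum /tail_sum big_seq1 /=; apply: num_valid_increasing => i j ij.
  by rewrite size_iota => jn; rewrite !nth_iota; lia.
have [k ->] : exists k, n = k.+1 + m by exists (n - m).-1; lia.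
have -> : k.+1 + m - m - 1 = k by lia.
have := tail_sum_rec k m; rewrite -!(D_geq_tail_sum R).
(* Splitting off the term [l = m] leaves $D_{\geq m+1}(n)$, which is [tail_sum k m.+1] and
   cancels. *)
rewrite {1}/D_geq big_ltn ?leq_addl ?ltnS //; last by lia.
rewrite -/(D_geq R m.+1 _) addSnnS addnC => /addnI ->.
rewrite (eq_bigr (fun i : 'I_k =>
    \sum_(j < m) 'C(k, i) * (tail_sum i (m - j) * tail_sum (k - i) j))); last first.
  by move=> i _; rewrite big_distrr.
rewrite exchange_big /= big_add1 /= big_mkord.
(* Reversal turns [m - j] into [j.+1], so that the new index, shifted by one, is the tail length of
   the unsheltered word. *)
rewrite (reindex_inj rev_ord_inj) /=; apply: eq_bigr => j _.
rewrite big_add1 /= big_mkord; apply: eq_bigr => i _.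
rewrite -!(D_geq_tail_sum R) mulnA subn1 /=; congr (_ * D_geq R _ _ * D_geq R _ _).
all: by have := ltn_ord i; have := ltn_ord j; lia.
Qed.
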